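(* Let $f,g\colon\mathbb{B}^n\to\mathbb{R}$ be pseudo-Boolean functions such that $\vee_kf=\vee_kg$ and $\wedge_kf=\wedge_kg$ for all $k\in[n]$. Then either $f=g$, or there exists a one-to-one function $\alpha\colon\mathbb{B}\to\mathbb{R}$ such that $f(\mathbf{x})=\alpha(x_1\oplus\cdots\oplus x_n)$ and $g(\mathbf{x})=\alpha(x_1\oplus\cdots\oplus x_n\oplus 1)$ for all $\mathbf{x}\in\mathbb{B}^n$.
   Context: $\mathbb{B}=\{0,1\}$, $[n]=\{1,\dots,n\}$, $\oplus$ denotes addition modulo $2$. For $k\in[n]$, $\mathbf{x}\in\mathbb{B}^n$, $a\in\mathbb{B}$, $\mathbf{x}_k^a$ is the tuple obtained from $\mathbf{x}$ by replacing its $k$-th component by $a$. The lattice derivatives of $h\colon\mathbb{B}^n\to\mathbb{R}$ are $\wedge_kh,\vee_kh\colon\mathbb{B}^n\to\mathbb{R}$, $\wedge_kh(\mathbf{x})=\min(h(\mathbf{x}_k^0),h(\mathbf{x}_k^1))$, $\vee_kh(\mathbf{x})=\max(h(\mathbf{x}_k^0),h(\mathbf{x}_k^1))$. *)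

(* Defs.v *)
From HB Require Import structures.
From mathcomp Require Import all_boot all_order all_algebra.
From mathcomp Require Import reals.

Set Implicit Arguments.
Unset Strict Implicit.
Unset Printing Implicit Defensive.

Import Order.TTheory GRing.Theory Num.Theory.
Local Open Scope ring_scope.

Definition cube (n : nat) := {ffun 'I_n -> bool}.

Definition subst_coord (n : nat) (x : cube n) (k : 'I_n) (a : bool) : cube n :=
  [ffun i => if i == k then a else x i].

Definition meet_deriv (R : realType) (n : nat) (k : 'I_n) (h : cube n -> R) :
    cube n -> R :=
  fun x => Num.min (h (subst_coord x k false)) (h (subst_coord x k true)).

Definition join_deriv (R : realType) (n : nat) (k : 'I_n) (h : cube n -> R) :
    cube n -> R :=
  fun x => Num.max (h (subst_coord x k false)) (h (subst_coord x k true)).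

Definition parity (n : nat) (x : cube n) : bool :=
  \big[addb/false]_(i < n) x i.

(* Main.v *)
(** At a point [x] where [f x != g x], equality of the lattice derivatives
    forces [f] and [g] to exchange their values when one coordinate is flipped,
    so they still differ at the flipped point. As any two points of the cube are
    joined by flips, one point of disagreement determines both functions
    everywhere, up to the parity of the number of flips. *)
Require Import Defs.
From mathcomp Require Import all_boot all_order all_algebra.
From mathcomp Require Import boolp reals.

Set Implicit Arguments.
Unset Strict Implicit.
Unset Printing Implicit Defensive.

Import Order.TTheory GRing.Theory Num.Theory.
Local Open Scope ring_scope.

Definition flip (n : nat) (x : cube n) (k : 'I_n) : cube n :=
  subst_coord x k (~~ x k).

Lemma subst_coord_id (n : nat) (x : cube n) (k : 'I_n) :
  subst_coord x k (x k) = x.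
Proof. by apply/ffunP => i; rewrite ffunE; case: eqP => [->|]. Qed.

(** Induction on the Hamming distance from [x] to [y], with [y] fixed and the base point moving:
    flipping [x] at a coordinate where it differs from [y] removes that coordinate from the
    difference set and adds none. *)
Lemma flip_ind (n : nat) (P : cube n -> Prop) (x : cube n) :
  P x -> (forall y k, P y -> P (flip y k)) -> forall y, P y.
Proof.
move=> Px Pflip y.
have [m] := ubnP #|[set i | x i != y i]|.
elim: m x Px => // m IHm x Px.
have [/eqP|[k]] := set_0Vmem [set i | x i != y i].
  move=> /eqP x_y _; suff -> : y = x by [].
  by apply/ffunP => i; move/setP/(_ i): x_y; rewrite !inE => /negbFE/eqP.
move=> k_diff; rewrite (cardsD1 k) k_diff add1n ltnS => lt_m.
apply: IHm (Pflip x k Px) _; apply: leq_ltn_trans lt_m; apply: subset_leq_card.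
apply/subsetP => i; rewrite !inE ffunE; case: (eqVneq i k) => [->|//].
by move: k_diff; rewrite inE; case: (x k) (y k) => [] [].
Qed.

Lemma parity_flip (n : nat) (x : cube n) (k : 'I_n) :
  parity (flip x k) = ~~ parity x.
Proof.
rewrite /parity (bigD1 k) // [in RHS](bigD1 k) //= ffunE eqxx -addNb; congr addb.
by apply: eq_bigr => i /negbTE ik; rewrite ffunE ik.
Qed.

(** In a total order the minimum and maximum determine the unordered pair, and [a != a'] leaves only
    the crossed matching. *)
Lemma min_max_swap (d : Order.disp_t) (T : orderType d) (a b a' b' : T) :
  Order.min a b = Order.min a' b' -> Order.max a b = Order.max a' b' ->
  a != a' -> b = a' /\ b' = a.
Proof.
by case: (ltgtP a b) => ?; case: (ltgtP a' b') => ? ? ?; subst; rewrite ?eqxx.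
Qed.

Lemma lattice_deriv_swap (R : realType) (n : nat) (f g : cube n -> R)
    (k : 'I_n) (x : cube n) :
  join_deriv k f = join_deriv k g -> meet_deriv k f = meet_deriv k g ->
  f x != g x -> f (flip x k) = g x /\ g (flip x k) = f x.
Proof.
move=> /(congr1 (@^~ x)) + /(congr1 (@^~ x)) +.
have := subst_coord_id x k; rewrite /flip /join_deriv /meet_deriv.
case: (x k) => /= -> maxE minE; last exact: min_max_swap.
(* Here [x k] is true, so [f x] and [g x] stand second in the minima and maxima and must be moved to
   the front. *)
by apply: min_max_swap; [rewrite minC minE minC | rewrite maxC maxE maxC].
Qed.

Theorem theorem22 (R : realType) (n : nat) (f g : cube n -> R)
  (hjoin : forall k : 'I_n, join_deriv k f = join_deriv k g)
  (hmeet : forall k : 'I_n, meet_deriv k f = meet_deriv k g) :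
  f = g \/
  exists alpha : bool -> R,
    injective alpha /\
    (forall x : cube n,
       f x = alpha (parity x) /\ g x = alpha (addb (parity x) true)).
Proof.
have [/forallP fg|/forallPn[x fgx]] := boolP [forall x, f x == g x].
  by left; apply/funext => x; apply/eqP.
(* The disagreement point [x] forces both values of [alpha]; [fgx] makes them distinct. *)
right; pose alpha b := if b == parity x then f x else g x.
have alpha_inj : injective alpha.
  move=> b c; rewrite /alpha; move/eqP: fgx => fgx.
  by case: b c (parity x) => [] [] [] //= /esym.
exists alpha; split=> //; apply: (flip_ind (x := x)) => [|y k [fy gy]].
  by rewrite /alpha eqxx addbT; case: (parity x).
(* Disagreement need not be carried along the induction: [f y] and [g y] are values of the injective
   [alpha] at opposite bits. *)
have fgy : f y != g y.
  by rewrite fy gy (inj_eq alpha_inj) addbT; case: (parity y).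
have [-> ->] := lattice_deriv_swap (hjoin k) (hmeet k) fgy.
by rewrite parity_flip fy gy !addbT negbK.
Qed.
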